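(* Let $C:y=y(x)$ be a smooth regular curve in $A^2$ whose curvature $k$ is constant. Then $C$ is affine congruent to (an arc of) one of the following curves: 1. $y=x^a$ with $a\neq0$; 2. $y=ax+bx\ln|x|$ with $a,b\in\mathbb R$; 3. $\sqrt{x^2+y^2}=e^{\frac ab\arctan(y/x)}$ with $a,b\in\mathbb R$, $b\ne0$, i.e. in polar coordinates $r=e^{\frac ab\theta}$, $\theta\in\mathbb R$ (a circle if $a=0$); 4. $y=e^x$.
   Context: $A^2$ is the real affine plane with affine coordinates $(x,y)$; two curves are affine congruent if one is mapped onto the other by a general affine transformation $Z\mapsto LZ+v$, $L\in GL_2(\mathbb R)$, $v\in\mathbb R^2$. Subscripts $x$ denote derivatives of $y(x)$. A smooth curve $y=y(x)$, $x$ in an open interval, is regular if $S_1=y_{xx}\neq0$ and $S_2=3y_{xx}y_{xxxx}-5y_{xxx}^2\neq0$ at all of its points. The curvature of a regular curve is $$k=\frac{\sqrt3\,(9y_{xx}^2y_{xxxxx}-45y_{xx}y_{xxx}y_{xxxx}+40y_{xxx}^3)}{3|S_2|^{3/2}}.$$ Each listed curve is taken on its natural domain of definition; an arc means a connected open piece. *)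

(* Defs.v *)
From HB Require Import structures.
From mathcomp Require Import all_boot all_order all_algebra.
From mathcomp Require Import all_classical all_reals all_analysis.

Set Implicit Arguments.
Unset Strict Implicit.
Unset Printing Implicit Defensive.

Import Order.TTheory GRing.Theory Num.Theory.
Import numFieldNormedType.Exports.

Local Open Scope classical_set_scope.
Local Open Scope ring_scope.

Section AffinePlaneCurves.
Context {R : realType}.
Implicit Types (y : R -> R) (I : set R) (C A G : set 'cV[R]_2).

Definition point (x1 x2 : R) : 'cV[R]_2 :=
  \col_(i < 2) (if i == ord0 then x1 else x2).

Definition smooth_on I y : Prop :=
  forall (n : nat) (x : R), I x -> derivable (derive1n n y) x 1.

Definition S1 y (x : R) : R := derive1n 2 y x.

Definition S2 y (x : R) : R :=
  3 * derive1n 2 y x * derive1n 4 y x - 5 * derive1n 3 y x ^+ 2.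

Definition regular_on I y : Prop :=
  forall x : R, I x -> S1 y x != 0 /\ S2 y x != 0.

Definition curvature y (x : R) : R :=
  Num.sqrt 3 *
    (9 * derive1n 2 y x ^+ 2 * derive1n 5 y x
     - 45 * derive1n 2 y x * derive1n 3 y x * derive1n 4 y x
     + 40 * derive1n 3 y x ^+ 3)
  / (3 * `|S2 y x| `^ (3 / 2)).

Definition graph_on I y : set 'cV[R]_2 := [set point x (y x) | x in I].

Definition affine_congruent C A : Prop :=
  exists2 L : 'M[R]_2, L \in unitmx &
  exists v : 'cV[R]_2, [set L *m Z + v | Z in C] = A.

(* "Open" is meant in the topology that G inherits from the plane. *)
Definition arc_of A G : Prop :=
  [/\ A !=set0, connected A &
      exists2 U : set 'cV[R]_2, open U & A = G `&` U].

Definition congruent_to_arc_of C G : Prop :=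
  exists2 A, arc_of A G & affine_congruent C A.

(* The graph of x |-> x^a over all real x for which x^a is a real number:
   every x > 0; x = 0 if a > 0; and x < 0 if a = p / q with p, q integers and
   q odd, where x^a is the (unique) real q-th root of x^p. The library's `^
   cannot be used for x < 0, where it takes the value 1. *)
Definition real_power (a x z : R) : Prop :=
  [\/ 0 < x /\ z = x `^ a,
      [/\ x = 0, 0 < a & z = 0] |
      x < 0 /\ exists (p : int) (q : nat),
        [/\ odd q, a = p%:~R / q%:R & z ^+ q = x ^ p]].

Definition power_curve (a : R) : set 'cV[R]_2 :=
  [set Z | exists x z : R, real_power a x z /\ Z = point x z].

Definition xlnx_curve (a b : R) : set 'cV[R]_2 :=
  graph_on [set x | x != 0] (fun x => a * x + b * x * ln `|x|).

(* The polar form with t ranging over all of R; the Cartesian equation with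
   the principal value of arctan(y/x) would only cut out pieces of it. *)
Definition spiral_curve (a b : R) : set 'cV[R]_2 :=
  [set point (expR (a / b * t) * cos t) (expR (a / b * t) * sin t)
  | t in [set: R]].

Definition exp_curve : set 'cV[R]_2 := graph_on [set: R] expR.

End AffinePlaneCurves.

(* Main.v *)
Require Import Defs.
From HB Require Import structures.
From mathcomp Require Import all_boot all_order all_algebra.
From mathcomp Require Import all_classical all_reals all_analysis.
From mathcomp Require Import ring lra.
Import Order.TTheory GRing.Theory Num.Theory.
Import numFieldNormedType.Exports.
Local Open Scope classical_set_scope.
Local Open Scope ring_scope.

(** A curve of constant curvature is a piece of an orbit of a one-parameter group
    of affine maps; the listed curves are the normal forms of these orbits.

    Let [eps] be the sign of [S2], [q = sqrt |S2|] and [phi = y'' / q]. The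
    derivation [D = phi d/dx] is, up to a constant, differentiation by the arc
    length invariant under affine maps. If the curvature is constant, then
    [Z = (x, y)] satisfies an equation [D^3 Z = p D^2 Z + r D Z] with constant
    coefficients, so that [D Z = M Z + v] for a constant matrix [M] and a constant
    vector [v]. Instead of being obtained from the third order equation, the
    entries of [M] are written explicitly in terms of [y', y'', y''', q] and
    checked to have derivative zero ([constant_curvature_affine_field]). The trace
    and the determinant of [M] come out as [- eps c / 2] and
    [eps / 9 + c^2 / 18], where [c = sqrt 3 k]; they do not both vanish, so [M] is
    not nilpotent.

    It remains to classify the curves that are tangent to an affine field
    [Z |-> M Z + v] and lie on no line ([tangent_field_classification]). [D]
    preserves the space of affine functions of [x, y] restricted to the curve, and
    acts on their linear parts by [M]. In adapted affine coordinates [(xi, eta)]: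
    - for distinct real nonzero eigenvalues, [D xi = lam xi] and
      [D eta = mu eta], and the curve is [eta = xi^(mu / lam)]
      ([power_case]);
    - for eigenvalues [lam != 0] and [0], it is an exponential
      ([exponential_case]);
    - for a double eigenvalue, [D eta = lam eta + kap xi] gives
      [eta = a xi + b xi ln xi] ([logarithmic_case]);
    - for complex eigenvalues [alpha +- i w], it is an arc of the spiral
      [exp ((alpha / w + i) t)] ([spiral_case]).
    In each case no parameter on the curve has to be integrated. In the real
    cases a suitable combination of [xi], [eta] and their logarithms has derivative
    zero; the logarithms make sense because an eigenform of [D] that vanishes at
    one point vanishes everywhere ([linear_ode_nonvanishing]). In the complex
    case the parameter [t] is an arctangent of an affine function of the slope.

    That the image curve is relatively open in the model curve rests on one
    function that separates the points of the model, or of its part in a half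
    plane, and is strictly monotone along the curve ([arc_of_parametrized],
    [open_image]). *)

(** * Calculus on an open interval *)

Section PointwiseDerivatives.
Context {R : realType}.
Implicit Types (f g : R -> R) (x u v : R).

(** Not a type class: instance search would otherwise compete with the
    syntax-directed rules below. *)
Definition deriv_at f x u : Prop := is_derive x 1 f u.

Lemma deriv_eq f x u v : deriv_at f x u -> u = v -> deriv_at f x v.
Proof. by move=> hf <-. Qed.

Lemma deriv_cst (c x : R) : deriv_at (fun=> c) x 0.
Proof. exact: is_derive_cst. Qed.

Lemma deriv_id x : deriv_at (fun t : R => t) x 1.
Proof. exact: is_derive_id. Qed.

Lemma derivD f g x u v : deriv_at f x u -> deriv_at g x v ->
  deriv_at (fun t => f t + g t) x (u + v).
Proof. by move=> hf hg; exact: is_deriveD. Qed.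

Lemma derivN f x u : deriv_at f x u -> deriv_at (fun t => - f t) x (- u).
Proof. by move=> hf; exact: is_deriveN. Qed.

Lemma derivM f g x u v : deriv_at f x u -> deriv_at g x v ->
  deriv_at (fun t => f t * g t) x (u * g x + f x * v).
Proof.
move=> hf hg; apply: (is_derive_eq (is_deriveM hf hg)).
by rewrite /GRing.scale /= addrC mulrC.
Qed.

Lemma derivX f n x u : deriv_at f x u ->
  deriv_at (fun t => f t ^+ n) x (n%:R * f x ^+ n.-1 * u).
Proof.
move=> hf; have -> : (fun t => f t ^+ n) = f ^+ n.
  by apply/funext => t; rewrite exprfctE.
exact: is_deriveX.
Qed.

Lemma derivV f x u : f x != 0 -> deriv_at f x u ->
  deriv_at (fun t => (f t)^-1) x (- u / f x ^+ 2).
Proof.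
move=> fx0 hf; apply: (is_derive_eq (is_deriveV fx0 hf)).
by rewrite /GRing.scale /= mulrC mulrN mulNr.
Qed.

Lemma deriv_exp f x u : deriv_at f x u ->
  deriv_at (fun t => expR (f t)) x (expR (f x) * u).
Proof. by move=> hf; exact: (is_derive1_comp (is_derive_expR (f x)) hf). Qed.

Lemma deriv_cos f x u : deriv_at f x u ->
  deriv_at (fun t => cos (f t)) x (- sin (f x) * u).
Proof. by move=> hf; exact: (is_derive1_comp (is_derive_cos (f x)) hf). Qed.

Lemma deriv_sin f x u : deriv_at f x u ->
  deriv_at (fun t => sin (f t)) x (cos (f x) * u).
Proof. by move=> hf; exact: (is_derive1_comp (is_derive_sin (f x)) hf). Qed.

Lemma deriv_atan f x u : deriv_at f x u ->
  deriv_at (fun t => atan (f t)) x ((1 + f x ^+ 2)^-1 * u).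
Proof. by move=> hf; exact: (is_derive1_comp (is_derive1_atan (f x)) hf). Qed.

Lemma deriv_ln f x u : 0 < f x -> deriv_at f x u ->
  deriv_at (fun t => ln (f t)) x ((f x)^-1 * u).
Proof. by move=> fx0 hf; exact: (is_derive1_comp (is_derive1_ln fx0) hf). Qed.

Lemma deriv_sqrt f x u : 0 < f x -> deriv_at f x u ->
  deriv_at (fun t => Num.sqrt (f t)) x ((2 * Num.sqrt (f x))^-1 * u).
Proof. by move=> fx0 hf; exact: (is_derive1_comp (is_derive1_sqrt fx0) hf). Qed.

End PointwiseDerivatives.

(* Differentiates a pointwise expression down to its atoms, for which
   derivatives are looked up among the hypotheses; side conditions such as
   positivity or non-vanishing are left over. *)
Ltac differentiate :=
  apply: deriv_eq;
  [ repeat (first [ eassumption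
                | apply: deriv_cst | apply: deriv_id | apply: derivM
                | apply: derivD | apply: derivN | apply: derivX
                | apply: derivV | apply: deriv_exp | apply: deriv_cos
                | apply: deriv_sin | apply: deriv_atan | apply: deriv_ln
                | apply: deriv_sqrt ])
  | cbv beta ].

Section OpenInterval.
Context {R : realType} {I : set R}.
Hypotheses (I_open : open I) (I_itv : is_interval I).
Implicit Types (f df g : R -> R).

Lemma deriv_at_continuous (f : R -> R) (x u : R) :
  deriv_at f x u -> {for x, continuous f}.
Proof.
by move=> [fx _]; apply: differentiable_continuous; apply/derivable1_diffP.
Qed.

Lemma segment_within {f df a b} : I a -> I b ->
  (forall x, I x -> deriv_at f x (df x)) -> {within `[a, b], continuous f}.
Proof.
move=> Ia Ib hf; apply: continuous_in_subspaceT => x.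
rewrite inE /= in_itv /= => xab.
exact: deriv_at_continuous (hf x (I_itv _ _ Ia Ib x xab)).
Qed.

Lemma mean_value {f df a b} : I a -> I b -> a < b ->
  (forall x, I x -> deriv_at f x (df x)) ->
  exists2 c, I c & f b - f a = df c * (b - a).
Proof.
move=> Ia Ib ab hf.
have Iab c : c \in `]a, b[%R -> I c.
  rewrite in_itv /= => /andP[ac cb].
  by apply: (I_itv _ _ Ia Ib); rewrite !ltW.
have [c cab ->] := MVT ab (fun x xab => hf x (Iab x xab))
  (segment_within Ia Ib hf).
by exists c => //; exact: Iab.
Qed.

Lemma derive0_constant {f} : (forall x, I x -> deriv_at f x 0) ->
  forall x z, I x -> I z -> f x = f z.
Proof.
move=> hf; suff lt_case x z : I x -> I z -> x < z -> f x = f z.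
  by move=> x z Ix Iz; case: (ltgtP x z) => [/lt_case|/lt_case H|->//];
    [exact | rewrite H].
move=> Ix Iz xz; have [c _] := mean_value Ix Iz xz hf.
by rewrite mul0r => /subr0_eq.
Qed.

Lemma nonvanishing_constant_sign {f df} :
  (forall x, I x -> deriv_at f x (df x)) ->
  (forall x, I x -> f x != 0) ->
  forall x z, I x -> I z -> 0 < f x * f z.
Proof.
move=> hf f0; suff le_case x z : I x -> I z -> x <= z -> 0 < f x * f z.
  move=> x z Ix Iz; have [/le_case|/ltW/le_case H] := leP x z; first exact.
  by rewrite mulrC; exact: H.
move=> Ix Iz xz; rewrite ltNge; apply/negP => fxz.
have [|c cxz fc] := IVT (v := 0) xz (segment_within Ix Iz hf).
  move: fxz; have [fx|fx] := leP (f x) (f z) => fxz; nra.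
have : I c by move: cxz; rewrite in_itv /=; exact: (I_itv _ _ Ix Iz).
by move=> /f0 /eqP.
Qed.

(** A solution of [P' = g P] that vanishes somewhere vanishes everywhere: if
    [|g| <= C] on a segment starting at the zero, then [P^2 exp(-2Cx)] is
    nonnegative and nonincreasing there. *)
Lemma linear_ode_zero_right {P g dg a b} : I a -> I b -> a <= b ->
  (forall x, I x -> deriv_at P x (g x * P x)) ->
  (forall x, I x -> deriv_at g x (dg x)) -> P a = 0 -> P b = 0.
Proof.
move=> Ia Ib ab hP hg Pa.
have Iab c : c \in `[a, b]%R -> I c.
  by rewrite in_itv /= => cab; exact: (I_itv _ _ Ia Ib).
have [m _ gm] := EVT_max ab (segment_within Ia Ib hg).
set C := g m.
pose h x := P x ^+ 2 * expR (- (2 * C) * x).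
pose dh x := 2 * (g x - C) * h x.
have h_deriv x : I x -> deriv_at h x (dh x).
  move=> Ix; have hPx := hP x Ix.
  rewrite /h; differentiate; rewrite /dh /h; ring.
have [ba|ab'] := eqVneq a b; first by rewrite -ba.
have lt_ab : a < b by rewrite lt_neqAle ab' ab.
have Ioo c : c \in `]a, b[%R -> c \in `[a, b]%R.
  by rewrite !in_itv /= => /andP[/ltW -> /ltW ->].
have [c /Ioo cab] := MVT lt_ab (fun x xab => h_deriv x (Iab x (Ioo x xab)))
  (segment_within Ia Ib h_deriv).
have h_ge0 x : 0 <= h x by rewrite mulr_ge0 ?sqr_ge0 ?expR_ge0.
have ha : h a = 0 by rewrite /h Pa expr0n mul0r.
have := gm _ cab; rewrite -/C => gC; rewrite ha subr0 => hb.
have : h b = 0.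
  apply/eqP; rewrite eq_le h_ge0 andbT hb mulr_le0_ge0 ?subr_ge0 //.
  by rewrite mulr_le0_ge0 ?h_ge0 // mulr_ge0_le0 // subr_le0.
by move=> /eqP; rewrite mulf_eq0 (gt_eqF (expR_gt0 _)) orbF sqrf_eq0 => /eqP.
Qed.

(** The mean value theorem makes [f] strictly monotone, so by the intermediate
    value theorem [f] covers a neighborhood of each of its values. The factor
    [s] stands for the common sign of the values of [df]. *)
Lemma open_image {f df} (s : R) :
  (forall x, I x -> deriv_at f x (df x)) ->
  (forall x, I x -> 0 < s * df x) -> open (f @` I).
Proof.
move=> hf sdf; rewrite openE => _ [x Ix <-].
have mono a b : I a -> I b -> a < b -> 0 < s * (f b - f a).
  move=> Ia Ib ab; have [c Ic ->] := mean_value Ia Ib ab hf.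
  by rewrite mulrA mulr_gt0 ?sdf ?subr_gt0.
have [e /= e0 eI] := (nbhs_ballP _ _).1 (open_nbhs_nbhs (conj I_open Ix)).
have e2 : 0 < e / 2 by rewrite divr_gt0.
have Il : I (x - e / 2).
  by apply: eI; rewrite /ball /= opprB addrC subrK gtr0_norm // gtr_pMr //; lra.
have Ir : I (x + e / 2).
  by apply: eI; rewrite /ball /= opprD addrA subrr sub0r normrN gtr0_norm //; lra.
have lx : x - e / 2 < x by lra.
have xr : x < x + e / 2 by lra.
have m1 := mono _ _ Il Ix lx; have m2 := mono _ _ Ix Ir xr.
set l := x - e / 2 in m1 Il lx *; set r := x + e / 2 in m2 Ir xr *.
have lr : l <= r by lra.
have s0 : s != 0 by apply: contraTneq m1 => ->; rewrite mul0r ltxx.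
have ivt v := IVT (v := v) lr (segment_within Il Ir hf).
have Ilr c : c \in `[l, r]%R -> I c.
  by rewrite in_itv /= => ?; exact: (I_itv _ _ Il Ir).
apply/nbhs_ballP; exists (Num.min `|f x - f l| `|f r - f x|).
  rewrite /= lt_min !normr_gt0.
  by apply/andP; split; apply: contraTneq isT => h0; [move: m1|move: m2];
    rewrite h0 mulr0 ltxx.
move=> v; rewrite /ball /= lt_min => /andP[v1 v2].
have [|c /Ilr Ic <-] := ivt v; last by exists c.
have [sp|sn|s00] := ltgtP 0 s; last by rewrite -s00 eqxx in s0.
- move: m1 m2; rewrite !pmulr_rgt0 // => m1 m2.
  move: v1 v2; rewrite (gtr0_norm m1) (gtr0_norm m2) !ltr_distl.
  move=> v1 v2; have [|] := leP (f l) (f r) => ?; lra.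
- move: m1 m2; rewrite !nmulr_rgt0 // => m1 m2.
  move: v1 v2; rewrite (ltr0_norm m1) (ltr0_norm m2) !ltr_distl.
  move=> v1 v2; have [|] := leP (f l) (f r) => ?; lra.
Qed.

End OpenInterval.

(** Uniqueness for a linear equation of order one, towards both sides. *)
Lemma linear_ode_nonvanishing {R : realType} {I : set R} {P g dg : R -> R}
    {a b : R} (I_itv : is_interval I) : I a -> I b ->
  (forall x, I x -> deriv_at P x (g x * P x)) ->
  (forall x, I x -> deriv_at g x (dg x)) -> P a != 0 -> P b != 0.
Proof.
move=> Ia Ib hP hg; apply: contra => /eqP Pb; apply/eqP.
have [ba|/ltW ab] := leP b a.
  exact: (linear_ode_zero_right I_itv Ib Ia ba hP hg Pb).
(* The reflection x |-> - x turns a zero on the right into one on the left. *)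
pose J := [set x | I (- x)].
have J_itv : is_interval J.
  move=> x z Jx Jz t /andP[xt tz]; apply: (I_itv _ _ Jz Jx).
  by rewrite !lerN2 xt tz.
have refl (f : R -> R) x u : deriv_at f (- x) u ->
    deriv_at (fun t => f (- t)) x (- u).
  move=> hf; have hN : deriv_at (-%R : R -> R) x (- 1).
    by apply: derivN; exact: deriv_id.
  by rewrite -mulrN1; exact: (is_derive1_comp hf hN).
have JNa : J (- a) by rewrite /J /= opprK.
have JNb : J (- b) by rewrite /J /= opprK.
have hPN x : J x -> deriv_at (fun t => P (- t)) x (- g (- x) * P (- x)).
  by move=> Jx; rewrite mulNr; apply: refl; exact: hP.
have hgN x : J x -> deriv_at (fun t => - g (- t)) x (- - dg (- x)).
  by move=> Jx; apply: derivN; apply: refl; exact: hg.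
have ba : - b <= - a by rewrite lerN2.
have := linear_ode_zero_right J_itv JNb JNa ba hPN hgN.
by rewrite !opprK; exact.
Qed.

(** In the parameter [s] with [ds = dx / rate], the function [X + i Y] solves
    [Z' = (alpha + i w) Z] and [theta] increases at speed [w], so that
    [exp (- (alpha / w + i) theta) (X + i Y)] is a constant [A + i B]. *)
Lemma damped_rotation_solution {R : realType} {I : set R}
    {X Y theta rate : R -> R} {alpha w x0 : R} (I_itv : is_interval I) :
  I x0 -> w != 0 -> (forall x, I x -> rate x != 0) ->
  (forall x, I x -> deriv_at X x ((alpha * X x - w * Y x) / rate x)) ->
  (forall x, I x -> deriv_at Y x ((alpha * Y x + w * X x) / rate x)) ->
  (forall x, I x -> deriv_at theta x (w / rate x)) ->
  exists A B, forall x, I x ->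
    X x = expR (alpha / w * theta x) * (A * cos (theta x) - B * sin (theta x)) /\
    Y x = expR (alpha / w * theta x) * (A * sin (theta x) + B * cos (theta x)).
Proof.
move=> x0I w0 rate_neq0 X_deriv Y_deriv theta_deriv.
pose E x := expR (alpha / w * theta x).
have E_neq0 x : E x != 0 by rewrite /E gt_eqF ?expR_gt0.
have E_inv x : expR (- (alpha / w) * theta x) = (E x)^-1.
  by rewrite mulNr expRN.
have trig x : cos (theta x) ^+ 2 = 1 - sin (theta x) ^+ 2 := cos2sin2 _.
pose fA x := expR (- (alpha / w) * theta x) *
  (X x * cos (theta x) + Y x * sin (theta x)).
pose fB x := expR (- (alpha / w) * theta x) *
  (Y x * cos (theta x) - X x * sin (theta x)).
have fA_deriv z : I z -> deriv_at fA z 0.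
  move=> Iz; have hX := X_deriv z Iz; have hY := Y_deriv z Iz.
  have ht := theta_deriv z Iz.
  have p0 := rate_neq0 z Iz.
  by rewrite /fA; differentiate; field; rewrite p0 w0.
have fA_cst x (Ix : I x) := derive0_constant I_itv fA_deriv x x0 Ix x0I.
have fB_deriv z : I z -> deriv_at fB z 0.
  move=> Iz; have hX := X_deriv z Iz; have hY := Y_deriv z Iz.
  have ht := theta_deriv z Iz.
  have p0 := rate_neq0 z Iz.
  by rewrite /fB; differentiate; field; rewrite p0 w0.
have fB_cst x (Ix : I x) := derive0_constant I_itv fB_deriv x x0 Ix x0I.
set A := fA x0 in fA_cst; set B := fB x0 in fB_cst.
have XE x : I x -> X x = E x * (A * cos (theta x) - B * sin (theta x)).
  move=> Ix; rewrite -(fA_cst x Ix) -(fB_cst x Ix) /fA /fB E_inv.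
  transitivity (X x * (cos (theta x) ^+ 2 + sin (theta x) ^+ 2)).
    by rewrite trig subrK mulr1.
  by field.
have YE x : I x -> Y x = E x * (A * sin (theta x) + B * cos (theta x)).
  move=> Ix; rewrite -(fA_cst x Ix) -(fB_cst x Ix) /fA /fB E_inv.
  transitivity (Y x * (cos (theta x) ^+ 2 + sin (theta x) ^+ 2)).
    by rewrite trig subrK mulr1.
  by field.
by exists A, B => x Ix; split; [exact: XE | exact: YE].
Qed.


(** * Arcs and affine congruence *)

Section Arcs.
Context {R : realType} {I : set R}.
Hypotheses (I_open : open I) (I_itv : is_interval I) (I_nonempty : I !=set0).

(** The arc cut out of [G] by [V] and by the values of [F]: since [f] is [F]
    along the parametrized curve and [f @` I] is open, the curve is relatively
    open as soon as [F] separates the points of [G] lying in [V]. *)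
Lemma arc_of_parametrized {xi eta f dxi deta : R -> R} {G : set 'cV[R]_2}
    (V : set 'cV[R]_2) (F : 'cV[R]_2 -> R) :
  (forall x, I x -> deriv_at xi x (dxi x)) ->
  (forall x, I x -> deriv_at eta x (deta x)) ->
  open (f @` I) -> continuous F -> open V ->
  (forall x, I x -> [/\ G (Defs.point (xi x) (eta x)),
      V (Defs.point (xi x) (eta x)) & F (Defs.point (xi x) (eta x)) = f x]) ->
  (forall Z x, G Z -> V Z -> I x -> F Z = f x ->
      Z = Defs.point (xi x) (eta x)) ->
  arc_of [set Defs.point (xi x) (eta x) | x in I] G.
Proof.
move=> hxi heta fI cF oV onG sepG; split.
- by have [x Ix] := I_nonempty; exists (Defs.point (xi x) (eta x)), x.
- apply: connected_continuous_connected; first exact/connected_intervalP.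
  have -> : (fun x => Defs.point (xi x) (eta x)) =
      (fun x => xi x *: Defs.point 1 0 + eta x *: Defs.point 0 1).
    apply/funext => x; apply/matrixP => i j; rewrite !mxE.
    by case: ifP => _; rewrite ?mulr1 ?mulr0 ?addr0 ?add0r.
  apply: continuous_in_subspaceT => x /set_mem Ix.
  apply: cvgD; apply: cvgZr_tmp.
    exact: deriv_at_continuous (hxi x Ix).
  exact: deriv_at_continuous (heta x Ix).
- exists (V `&` F @^-1` (f @` I)).
    by apply: openI => //; apply: open_comp => // Z _; exact: cF.
  apply/seteqP; split => [_ [x Ix <-] | Z [GZ [VZ [x Ix fx]]]].
    by have [? ? ?] := onG x Ix; split=> //; split=> //; exists x.
  by exists x => //; rewrite -(sepG Z x).
Qed.

End Arcs.

Section AffineForms.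
Context {R : realType}.

(** An affine function of the plane, read along the graph of [y]. *)
Definition affine_form (y : R -> R) (al be ga x : R) : R :=
  al * x + be * y x + ga.

Lemma graph_affine_congruent (I : set R) (y : R -> R)
    (al be ga al' be' ga' : R) :
  al * be' - be * al' != 0 ->
  affine_congruent (graph_on I y)
    [set Defs.point (affine_form y al be ga x) (affine_form y al' be' ga' x)
    | x in I].
Proof.
move=> det0.
exists (\matrix_(i < 2, j < 2)
  if i == ord0 then (if j == ord0 then al else be)
  else (if j == ord0 then al' else be')).
  rewrite unitmxE unitfE (expand_det_row _ ord0) !big_ord_recl big_ord0.
  rewrite /cofactor !det_mx11 !mxE /= expr0 expr1 mul1r mulN1r addr0 mulrN.
  exact: det0.
exists (Defs.point ga ga').
have imE x : (\matrix_(i < 2, j < 2)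
    if i == ord0 then (if j == ord0 then al else be)
    else (if j == ord0 then al' else be')) *m Defs.point x (y x)
    + Defs.point ga ga' =
    Defs.point (affine_form y al be ga x) (affine_form y al' be' ga' x).
  apply/matrixP => i j; rewrite !mxE !big_ord_recl big_ord0 !mxE /= addr0.
  by rewrite /affine_form; case: ifP.
apply/seteqP; split => [_ [_ [x Ix <-] <-] | _ [x Ix <-]].
  by exists x => //; rewrite imE.
by exists (Defs.point x (y x)); [exists x | exact: imE].
Qed.

Lemma coordinate_continuous (i : 'I_2) :
  continuous (fun Z : 'cV[R]_2 => Z i ord0).
Proof. exact: coord_continuous. Qed.

Lemma point_fst (u v : R) : Defs.point u v ord0 ord0 = u.
Proof. by rewrite mxE. Qed.

Lemma point_snd (u v : R) : Defs.point u v (lift ord0 ord0) ord0 = v.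
Proof. by rewrite mxE. Qed.

Lemma right_half_plane_open : open [set Z : 'cV[R]_2 | 0 < Z ord0 ord0].
Proof.
apply: (@open_comp _ _ (fun Z : 'cV[R]_2 => Z ord0 ord0) [set t | 0 < t]).
  by move=> Z _; exact: coordinate_continuous.
exact: open_gt.
Qed.

End AffineForms.

(** * Curves tangent to an affine vector field *)

Section TangentToAffineField.
Context {R : realType} {I : set R}.
Hypotheses (I_open : open I) (I_itv : is_interval I).
Variables (y dy ddy : R -> R) (m11 m12 v1 m21 m22 v2 x0 : R).
Hypothesis x0I : I x0.
Hypothesis y_deriv : forall x, I x -> deriv_at y x (dy x).
Hypothesis dy_deriv : forall x, I x -> deriv_at dy x (ddy x).
Hypothesis ddy_neq0 : forall x, I x -> ddy x != 0.
Let phi := affine_form y m11 m12 v1.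
Hypothesis phi_gt0 : forall x, I x -> 0 < phi x.
Hypothesis tangent : forall x, I x -> phi x * dy x = affine_form y m21 m22 v2 x.

(** With [D = phi d/dx], the derivation along the field, this says that [D]
    maps affine forms to affine forms, through the matrix of the field. *)
Lemma affine_form_deriv al be ga x : I x ->
  deriv_at (affine_form y al be ga) x
    (affine_form y (al * m11 + be * m21) (al * m12 + be * m22)
       (al * v1 + be * v2) x / phi x).
Proof.
move=> Ix; have hy := y_deriv x Ix; have p0 := lt0r_neq0 (phi_gt0 x Ix).
rewrite {1}/affine_form; differentiate.
apply: (mulIf p0); rewrite divfK // !mul0r !add0r mulr1 addr0 mulrDl.
rewrite -[be * dy x * phi x]mulrA [dy x * _]mulrC tangent // /phi /affine_form.
ring.
Qed.

Lemma affine_form_deriv_slope al be x : I x ->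
  phi x * (al + be * dy x) =
  affine_form y (al * m11 + be * m21) (al * m12 + be * m22)
    (al * v1 + be * v2) x.
Proof.
move=> Ix; rewrite mulrDr mulrCA tangent // /phi /affine_form; ring.
Qed.

(** The curve lies on no line: since [ddy] does not vanish, the mean value
    theorem gives two points with different slopes. *)
Lemma slope_not_constant al be :
  (forall x, I x -> al + be * dy x = 0) -> al = 0 /\ be = 0.
Proof.
move=> h.
have [e /= e0 eI] := (nbhs_ballP _ _).1 (open_nbhs_nbhs (conj I_open x0I)).
have Ir : I (x0 + e / 2).
  apply: eI; rewrite /ball /= opprD addrA subrr sub0r normrN gtr0_norm; lra.
have xr : x0 < x0 + e / 2 by lra.
have [c Ic dyE] := mean_value I_itv x0I Ir xr dy_deriv.
have be0 : be = 0.
  have : be * (dy (x0 + e / 2) - dy x0) = 0.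
    by have := h _ x0I; have := h _ Ir; lra.
  rewrite dyE => /eqP; rewrite !mulf_eq0 (negPf (ddy_neq0 c Ic)) /=.
  rewrite [x0 + _]addrC addrK => /orP[/eqP //|]; rewrite gt_eqF //; lra.
by have := h _ x0I; rewrite be0 mul0r addr0.
Qed.

(** Row vectors are the linear parts of affine forms, on which [D] acts. *)
Definition left_eigenvector lam al be : Prop :=
  [/\ al != 0 \/ be != 0, al * m11 + be * m21 = lam * al &
      al * m12 + be * m22 = lam * be].

Lemma left_eigenvector_exists lam :
  lam ^+ 2 - (m11 + m22) * lam + (m11 * m22 - m12 * m21) = 0 ->
  exists al be, left_eigenvector lam al be.
Proof.
move=> char0.
(* Up to sign, the witnesses are rows of the adjugate of the matrix minus lam,
   except when the matrix is scalar. *)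
have [m21_0|m21_n0] := eqVneq m21 0; last first.
  by exists m21, (lam - m11); split; [left | ring | lra].
have [m11_lam|m11_n] := eqVneq (lam - m11) 0; last first.
  by exists m21, (lam - m11); split; [right | ring | lra].
have [m12_0|m12_n0] := eqVneq m12 0; last first.
  have m11E : m11 = lam by lra.
  exists (m22 - lam), (- m12); split; last by ring.
    by right; rewrite oppr_eq0.
  by rewrite m21_0 m11E; ring.
by exists 1, 0; split; [left; exact: oner_neq0 | lra | rewrite m12_0; ring].
Qed.

(** An affine form [xi] with [D xi = lam xi], [lam != 0], never vanishes: a zero
    would make it vanish identically and put the curve on a line. It can
    therefore be normalized to a positive function. *)
Lemma eigenform_exists lam al be : lam != 0 -> left_eigenvector lam al be ->
  exists al' be' ga', [/\ left_eigenvector lam al' be',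
    affine_form y al' be' ga' x0 = 1,
    forall x, I x -> 0 < affine_form y al' be' ga' x &
    forall x, I x -> deriv_at (affine_form y al' be' ga') x
      (lam * affine_form y al' be' ga' x / phi x)].
Proof.
move=> lam0 [nz eq1 eq2].
pose ga := (al * v1 + be * v2) / lam.
pose f := affine_form y al be ga.
have formE x : affine_form y (al * m11 + be * m21) (al * m12 + be * m22)
    (al * v1 + be * v2) x = lam * f x.
  by rewrite eq1 eq2 /f /affine_form /ga; field.
have f_deriv x : I x -> deriv_at f x (lam / phi x * f x).
  move=> Ix; apply: deriv_eq (affine_form_deriv al be ga x Ix) _.
  by rewrite formE mulrAC.
pose dphi x := affine_form y (m11 * m11 + m12 * m21) (m11 * m12 + m12 * m22)
  (m11 * v1 + m12 * v2) x / phi x.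
have phi_deriv x : I x -> deriv_at phi x (dphi x).
  exact: affine_form_deriv.
have rate_deriv x : I x ->
    deriv_at (fun t => lam / phi t) x (- lam * dphi x / phi x ^+ 2).
  move=> Ix; have hphi := phi_deriv x Ix.
  have p0 := lt0r_neq0 (phi_gt0 x Ix).
  by differentiate; field.
have [x1 I1 f1] : exists2 x, I x & f x != 0.
  apply: contrapT => nex.
  have f0 x : I x -> f x = 0.
    by move=> Ix; apply: contrapT => /eqP fx; apply: nex; exists x.
  have [|al0 be0] := slope_not_constant al be.
    move=> x Ix; have := affine_form_deriv_slope al be x Ix.
    rewrite formE f0 // mulr0 => /eqP; rewrite mulf_eq0.
    by rewrite (negPf (lt0r_neq0 (phi_gt0 x Ix))) => /eqP.
  by case: nz; rewrite ?al0 ?be0 eqxx.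
have f_neq0 x : I x -> f x != 0.
  move=> Ix.
  exact: (linear_ode_nonvanishing I_itv I1 Ix f_deriv rate_deriv f1).
have k0 := f_neq0 x0 x0I.
have scaleE x :
    affine_form y (al / f x0) (be / f x0) (ga / f x0) x = f x / f x0.
  by rewrite /f /affine_form in k0 *; field.
exists (al / f x0), (be / f x0), (ga / f x0); split.
- split; last by rewrite -!(mulrAC _ _ (f x0)^-1) -mulrDl eq2 mulrA.
    by case: nz => nz; [left | right]; rewrite mulf_neq0 ?invr_eq0.
  by rewrite -!(mulrAC _ _ (f x0)^-1) -mulrDl eq1 mulrA.
- by rewrite scaleE divff.
- move=> x Ix; rewrite scaleE.
  have -> : f x / f x0 = f x * f x0 / f x0 ^+ 2 by field.
  rewrite divr_gt0 ?exprn_even_gt0 //.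
  exact: (nonvanishing_constant_sign I_itv f_deriv f_neq0).
- move=> x Ix; rewrite scaleE.
  have -> : affine_form y (al / f x0) (be / f x0) (ga / f x0) =
      fun t => f t / f x0 by apply/funext => t; exact: scaleE.
  have hf := f_deriv x Ix; have p0 := lt0r_neq0 (phi_gt0 x Ix).
  by differentiate; field; rewrite p0 k0.
Qed.


Lemma left_eigenvectors_independent lam mu al be al' be' : lam != mu ->
  left_eigenvector lam al be -> left_eigenvector mu al' be' ->
  al * be' - be * al' != 0.
Proof.
move=> lam_mu [nz e1 e2] [nz' e1' e2']; apply/eqP => d0.
have sub0 : lam - mu != 0 by rewrite subr_eq0.
have z1 : al * al' = 0.
  apply: (mulfI sub0); rewrite mulr0.
  have -> : (lam - mu) * (al * al') =
    al' * (lam * al) - al * (mu * al') by ring.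
  rewrite -e1 -e1'.
  have -> : al' * (al * m11 + be * m21) - al * (al' * m11 + be' * m21) =
    - m21 * (al * be' - be * al') by ring.
  by rewrite d0 mulr0.
have z2 : be * be' = 0.
  apply: (mulfI sub0); rewrite mulr0.
  have -> : (lam - mu) * (be * be') =
    be' * (lam * be) - be * (mu * be') by ring.
  rewrite -e2 -e2'.
  have -> : be' * (al * m12 + be * m22) - be * (al' * m12 + be' * m22) =
    m12 * (al * be' - be * al') by ring.
  by rewrite d0 mulr0.
have z3 : al * be' = 0.
  apply: (mulfI sub0); rewrite mulr0.
  have -> : (lam - mu) * (al * be') = al' * (lam * be) - al * (mu * be') +
    lam * (al * be' - be * al') by ring.
  rewrite -e2 -e2'.
  have -> : al' * (al * m12 + be * m22) - al * (al' * m12 + be' * m22) +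
    lam * (al * be' - be * al') = (lam - m22) * (al * be' - be * al') by ring.
  by rewrite d0 mulr0.
have z4 : be * al' = 0 by rewrite -z3; apply/esym/subr0_eq.
have cancel (u v : R) : u != 0 -> u * v = 0 -> v == 0.
  by move=> u0 /eqP; rewrite mulf_eq0 (negPf u0).
by case: nz => u0; case: nz' => /negP; apply; apply: (cancel _ _ u0).
Qed.

(** Two nonzero eigenvalues: in eigencoordinates [D xi = lam xi] and
    [D eta = mu eta], so [ln eta - (mu / lam) ln xi] is constant. *)
Lemma power_case lam mu al be al' be' : lam != 0 -> mu != 0 -> lam != mu ->
  left_eigenvector lam al be -> left_eigenvector mu al' be' ->
  congruent_to_arc_of (graph_on I y) (power_curve (mu / lam)).
Proof.
move=> lam0 mu0 lam_mu /(eigenform_exists _ _ _ lam0).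
move=> [a1 [b1 [c1 [eig1 xi1 xi_gt0 xi_deriv]]]].
move=> /(eigenform_exists _ _ _ mu0).
move=> [a2 [b2 [c2 [eig2 eta1 eta_gt0 eta_deriv]]]].
set xi := affine_form y a1 b1 c1 in xi1 xi_gt0 xi_deriv.
set eta := affine_form y a2 b2 c2 in eta1 eta_gt0 eta_deriv.
have eta_xi x : I x -> eta x = xi x `^ (mu / lam).
  move=> Ix; apply: ln_inj; rewrite ?posrE ?powR_gt0 ?xi_gt0 ?eta_gt0 //.
  rewrite ln_powR; apply: subr0_eq.
  rewrite (derive0_constant I_itv
    (f := fun t => ln (eta t) - mu / lam * ln (xi t)) _ x x0 Ix x0I) ?xi1 ?eta1 ?ln1;
    first by rewrite mulr0 subrr.
  move=> z Iz; have hxi := xi_deriv z Iz; have heta := eta_deriv z Iz.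
  have xi0 := xi_gt0 z Iz; have eta0 := eta_gt0 z Iz.
  have p0 := lt0r_neq0 (phi_gt0 z Iz).
  differentiate; field.
  by rewrite p0 lam0 !lt0r_neq0.
exists [set Defs.point (xi x) (eta x) | x in I]; last first.
  apply: graph_affine_congruent.
  exact: left_eigenvectors_independent lam_mu eig1 eig2.
apply: (arc_of_parametrized I_itv (ex_intro _ x0 x0I)
  [set Z | 0 < Z ord0 ord0] (fun Z => Z ord0 ord0) (f := xi)
  xi_deriv eta_deriv).
- apply: (open_image I_open I_itv lam xi_deriv) => x Ix.
  have -> : lam * (lam * xi x / phi x) = lam ^+ 2 * xi x / phi x by ring.
  by rewrite divr_gt0 ?phi_gt0 // mulr_gt0 ?xi_gt0 // exprn_even_gt0.
- exact: coordinate_continuous.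
- exact: right_half_plane_open.
- move=> x Ix; rewrite /= point_fst; split; [|exact: xi_gt0|by []].
  exists (xi x), (eta x); split=> //; apply: Or31; split; first exact: xi_gt0.
  exact: eta_xi.
- move=> Z x [t [z [tz ->]]] /=; rewrite point_fst => t0 Ix tx.
  rewrite eta_xi // -tx; case: tz => [[_ -> //]|[t00]|[t_lt0]].
    by rewrite t00 ltxx in t0.
  by have := lt_trans t0 t_lt0; rewrite ltxx.
Qed.


(** Eigenvalues [lam != 0] and [0]: in eigencoordinates [D xi = lam xi] while
    [D eta] is a constant, so [ln xi - eta] is constant once [eta] is scaled to
    have [D eta = lam]. *)
Lemma exponential_case lam al be al' be' : lam != 0 ->
  left_eigenvector lam al be -> left_eigenvector 0 al' be' ->
  congruent_to_arc_of (graph_on I y) exp_curve.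
Proof.
move=> lam0 /(eigenform_exists _ _ _ lam0).
move=> [a1 [b1 [c1 [eig1 xi1 xi_gt0 xi_deriv]]]] eig0.
set xi := affine_form y a1 b1 c1 in xi1 xi_gt0 xi_deriv.
have [nz eq1 eq2] := eig0; rewrite !mul0r in eq1 eq2.
pose kap := al' * v1 + be' * v2.
have kap0 : kap != 0.
  apply/eqP => k0; have [|al0 be0] := slope_not_constant al' be'.
    move=> x Ix; have := affine_form_deriv_slope al' be' x Ix.
    rewrite eq1 eq2 -/kap k0 /affine_form !mul0r !addr0 => /eqP.
    by rewrite mulf_eq0 (negPf (lt0r_neq0 (phi_gt0 x Ix))) => /eqP.
  by case: nz; rewrite ?al0 ?be0 eqxx.
pose a2 := lam * al' / kap; pose b2 := lam * be' / kap.
pose c2 := - (a2 * x0 + b2 * y x0).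
pose eta := affine_form y a2 b2 c2.
have eta0 : eta x0 = 0 by rewrite /eta /affine_form /c2 subrr.
have eta_deriv x : I x -> deriv_at eta x (lam / phi x).
  move=> Ix; apply: deriv_eq (affine_form_deriv a2 b2 c2 x Ix) _.
  congr (_ / _); have -> : lam = lam * kap / kap by rewrite mulfK.
  rewrite /affine_form /a2 /b2 /kap in kap0 *.
  have -> : lam * al' / kap * m11 + lam * be' / kap * m21 =
    lam / kap * (al' * m11 + be' * m21) by rewrite /kap; field.
  have -> : lam * al' / kap * m12 + lam * be' / kap * m22 =
    lam / kap * (al' * m12 + be' * m22) by rewrite /kap; field.
  by rewrite eq1 eq2 /kap; field.
have xi_eta x : I x -> xi x = expR (eta x).
  move=> Ix; rewrite -[xi x]lnK ?posrE ?xi_gt0 //; congr expR.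
  apply: subr0_eq.
  rewrite (derive0_constant I_itv (f := fun t => ln (xi t) - eta t)
    _ x x0 Ix x0I) ?xi1 ?eta0 ?ln1 ?subrr //.
  move=> z Iz; have hxi := xi_deriv z Iz; have heta := eta_deriv z Iz.
  have xi0 := xi_gt0 z Iz; have p0 := lt0r_neq0 (phi_gt0 z Iz).
  by differentiate; field; rewrite p0 lt0r_neq0.
exists [set Defs.point (eta x) (xi x) | x in I]; last first.
  apply: graph_affine_congruent.
  have lam_0 : 0 != lam by rewrite eq_sym.
  have d0 := left_eigenvectors_independent _ _ _ _ _ _ lam_0 eig0 eig1.
  have -> : a2 * b1 - b2 * a1 = lam / kap * (al' * b1 - be' * a1).
    by rewrite /a2 /b2; field.
  by rewrite !mulf_neq0 ?invr_eq0.
apply: (arc_of_parametrized I_itv (ex_intro _ x0 x0I) setT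
  (fun Z => Z ord0 ord0) (f := eta) eta_deriv xi_deriv).
- apply: (open_image I_open I_itv lam eta_deriv) => x Ix.
  by rewrite mulrA divr_gt0 ?phi_gt0 // -expr2 exprn_even_gt0.
- exact: coordinate_continuous.
- exact: openT.
- move=> x Ix; rewrite point_fst; split=> //.
  by exists (eta x) => //; rewrite xi_eta.
- move=> Z x [t _ <-] _ Ix; rewrite point_fst => ->.
  by rewrite xi_eta.
Qed.

(** A double eigenvalue [lam != 0]: completing an eigenform [xi] to coordinates
    [(xi, eta)] gives [D eta = lam eta + kap xi], because the matrix of the
    field minus [lam] is nilpotent. Hence [D (eta / xi) = kap], while
    [D (ln xi) = lam]. *)
Lemma logarithmic_case lam al be : lam != 0 ->
  m11 + m22 = 2 * lam -> left_eigenvector lam al be ->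
  exists a b, congruent_to_arc_of (graph_on I y) (xlnx_curve a b).
Proof.
move=> lam0 trE /(eigenform_exists _ _ _ lam0).
move=> [a1 [b1 [c1 [[nz eq1 eq2] xi1 xi_gt0 xi_deriv]]]].
set xi := affine_form y a1 b1 c1 in xi1 xi_gt0 xi_deriv.
have norm0 : a1 ^+ 2 + b1 ^+ 2 != 0.
  by rewrite paddr_eq0 ?sqr_ge0 // !sqrf_eq0 negb_and; apply/orP.
(* The second coordinate has linear part (- b1, a1), orthogonal to (a1, b1);
   (u1, u2) is its image under the matrix of the field minus lam. *)
pose u1 := - b1 * m11 + a1 * m21 + lam * b1.
pose u2 := - b1 * m12 + a1 * m22 - lam * a1.
pose kap := (u1 * a1 + u2 * b1) / (a1 ^+ 2 + b1 ^+ 2).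
have u_parallel : u1 * b1 = u2 * a1.
  apply: subr0_eq.
  have -> : u1 * b1 - u2 * a1 = a1 * (a1 * m11 + b1 * m21 - lam * a1)
    + b1 * (a1 * m12 + b1 * m22 - lam * b1) 
    - (a1 ^+ 2 + b1 ^+ 2) * (m11 + m22 - 2 * lam) by rewrite /u1 /u2; ring.
  by rewrite eq1 eq2 trE; ring.
have u1E : u1 = kap * a1.
  have -> : kap * a1 = (u1 * a1 ^+ 2 + b1 * (u2 * a1)) / (a1 ^+ 2 + b1 ^+ 2).
    by rewrite /kap; field.
  by rewrite -u_parallel; field.
have u2E : u2 = kap * b1.
  have -> : kap * b1 = (a1 * (u1 * b1) + u2 * b1 ^+ 2) / (a1 ^+ 2 + b1 ^+ 2).
    by rewrite /kap; field.
  by rewrite u_parallel; field.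
pose c2 := (- b1 * v1 + a1 * v2 - kap * c1) / lam.
pose eta := affine_form y (- b1) a1 c2.
have eta_deriv x : I x -> deriv_at eta x ((lam * eta x + kap * xi x) / phi x).
  move=> Ix; apply: deriv_eq (affine_form_deriv (- b1) a1 c2 x Ix) _.
  congr (_ / _); rewrite /eta /xi /affine_form.
  have -> : - b1 * m11 + a1 * m21 = kap * a1 - lam * b1.
    by rewrite -u1E /u1; ring.
  have -> : - b1 * m12 + a1 * m22 = kap * b1 + lam * a1.
    by rewrite -u2E /u2; ring.
  by rewrite /c2; field.
pose c := eta x0.
have eta_xi x : I x -> eta x = c * xi x + kap / lam * xi x * ln `|xi x|.
  move=> Ix; have xi_x0 := lt0r_neq0 (xi_gt0 x Ix).
  rewrite gtr0_norm ?xi_gt0 //.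
  have := derive0_constant I_itv
    (f := fun t => eta t / xi t - kap / lam * ln (xi t)) _ x x0 Ix x0I.
  rewrite xi1 ln1 mulr0 subr0 divr1 -/c => <-; first by field; rewrite lam0.
  move=> z Iz; have hxi := xi_deriv z Iz; have heta := eta_deriv z Iz.
  have xi0 := xi_gt0 z Iz; have xi_n0 := lt0r_neq0 xi0.
  have p0 := lt0r_neq0 (phi_gt0 z Iz).
  by differentiate; field; rewrite p0 lam0 xi_n0.
exists c, (kap / lam), [set Defs.point (xi x) (eta x) | x in I]; last first.
  apply: graph_affine_congruent.
  by have -> : a1 * a1 - b1 * - b1 = a1 ^+ 2 + b1 ^+ 2 by ring.
apply: (arc_of_parametrized I_itv (ex_intro _ x0 x0I)
  [set Z | 0 < Z ord0 ord0] (fun Z => Z ord0 ord0) (f := xi)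
  xi_deriv eta_deriv).
- apply: (open_image I_open I_itv lam xi_deriv) => x Ix.
  have -> : lam * (lam * xi x / phi x) = lam ^+ 2 * xi x / phi x by ring.
  by rewrite divr_gt0 ?phi_gt0 // mulr_gt0 ?xi_gt0 // exprn_even_gt0.
- exact: coordinate_continuous.
- exact: right_half_plane_open.
- move=> x Ix; rewrite /= point_fst; split; [|exact: xi_gt0|by []].
  by exists (xi x); [exact: lt0r_neq0 (xi_gt0 x Ix) | rewrite eta_xi].
- move=> Z x [t _ <-] /=; rewrite point_fst => _ Ix ->.
  by rewrite eta_xi.
Qed.


(** Complex eigenvalues [alpha +- i w]: around the fixed point of the field,
    [D] acts on suitable coordinates as [alpha + i w]. The slope of the velocity
    rotates with it, so an arctangent of the slope is an angle [theta] with
    [D theta = w]; undoing the rotation by [theta] and the dilation by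
    [exp (alpha theta / w)] leaves constants, which a similarity turns
    into [(1, 0)]. *)
Lemma spiral_case : (m11 - m22) ^+ 2 + 4 * (m12 * m21) < 0 ->
  exists a b, b != 0 /\ congruent_to_arc_of (graph_on I y) (spiral_curve a b).
Proof.
move=> disc; pose w := Num.sqrt (- ((m11 - m22) ^+ 2 + 4 * (m12 * m21))) / 2.
have w_gt0 : 0 < w by rewrite divr_gt0 // sqrtr_gt0; lra.
have w0 := lt0r_neq0 w_gt0.
have wE : w ^+ 2 = - ((m11 - m22) ^+ 2 / 4 + m12 * m21).
  rewrite /w expr_div_n sqr_sqrtr; [by field | lra].
have m12_0 : m12 != 0.
  by apply: contraTneq disc => ->; rewrite mul0r mulr0 addr0 -leNgt sqr_ge0.
pose alpha := (m11 + m22) / 2.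
pose d := m11 * m22 - m12 * m21.
have dE : d = alpha ^+ 2 + w ^+ 2 by rewrite wE /alpha /d; field.
have d0 : d != 0.
  by rewrite dE; apply: lt0r_neq0; rewrite ltr_wpDl ?sqr_ge0 // exprn_gt0.
(* (p1, p2) is the fixed point of the field. *)
pose p1 := (m12 * v2 - m22 * v1) / d; pose p2 := (m21 * v1 - m11 * v2) / d.
have p_fixed1 : m11 * p1 + m12 * p2 = - v1 by rewrite /p1 /p2 /d in d0 *; field.
have p_fixed2 : m21 * p1 + m22 * p2 = - v2 by rewrite /p1 /p2 /d in d0 *; field.
pose psi := affine_form y m21 m22 v2.
pose r1 := (alpha - m11) / w; pose r2 := - m12 / w.
pose X := affine_form y 1 0 (- p1).
pose Y := affine_form y r1 r2 (- (r1 * p1 + r2 * p2)).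
have v1E : v1 = - (m11 * p1 + m12 * p2) by rewrite p_fixed1 opprK.
have v2E : v2 = - (m21 * p1 + m22 * p2) by rewrite p_fixed2 opprK.
have m21E : m21 = - (w ^+ 2 + (m11 - m22) ^+ 2 / 4) / m12 by rewrite wE; field.
have X_deriv x : I x -> deriv_at X x ((alpha * X x - w * Y x) / phi x).
  move=> Ix; apply: deriv_eq (affine_form_deriv 1 0 (- p1) x Ix) _.
  congr (_ / _); rewrite /X /Y /affine_form v1E /r1 /r2; field.
  by rewrite w0.
have Y_deriv x : I x -> deriv_at Y x ((alpha * Y x + w * X x) / phi x).
  move=> Ix.
  apply: deriv_eq (affine_form_deriv r1 r2 (- (r1 * p1 + r2 * p2)) x Ix) _.
  congr (_ / _); rewrite /X /Y /affine_form v1E v2E /r1 /r2 /alpha m21E; field.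
  by rewrite w0 m12_0.
have phi_deriv x : I x -> deriv_at phi x ((m11 * phi x + m12 * psi x) / phi x).
  move=> Ix; apply: deriv_eq (affine_form_deriv m11 m12 v1 x Ix) _.
  by congr (_ / _); rewrite /phi /psi /affine_form; ring.
have psi_deriv x : I x -> deriv_at psi x ((m21 * phi x + m22 * psi x) / phi x).
  move=> Ix; apply: deriv_eq (affine_form_deriv m21 m22 v2 x Ix) _.
  by congr (_ / _); rewrite /phi /psi /affine_form; ring.
(* w q is an affine function of the slope psi / phi; as a function on the
   curve, q solves D q = w (1 + q^2). *)
pose q x := ((m22 - m11) / 2 - m12 * (psi x / phi x)) / w.
pose theta x := atan (q x).
have theta_deriv x : I x -> deriv_at theta x (w / phi x).
  move=> Ix; have hphi := phi_deriv x Ix; have hpsi := psi_deriv x Ix.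
  have p0 := lt0r_neq0 (phi_gt0 x Ix).
  have q_deriv : deriv_at q x (w * (1 + q x ^+ 2) / phi x).
    rewrite {1}/q; differentiate; rewrite /q.
    by rewrite m21E; field; rewrite p0 w0 m12_0.
  have q2 : 1 + q x ^+ 2 != 0.
    by apply: lt0r_neq0; rewrite ltr_pwDl ?sqr_ge0.
  by rewrite /theta; differentiate; field; rewrite p0 q2.
pose E x := expR (alpha / w * theta x).
have E_neq0 x : E x != 0 by rewrite /E gt_eqF ?expR_gt0.
have trig x : cos (theta x) ^+ 2 = 1 - sin (theta x) ^+ 2 := cos2sin2 _.
have [A [B XYE]] := damped_rotation_solution I_itv x0I w0
  (fun x Ix => lt0r_neq0 (phi_gt0 x Ix)) X_deriv Y_deriv theta_deriv.
have XE x : I x -> X x = E x * (A * cos (theta x) - B * sin (theta x)).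
  by case/XYE.
have YE x : I x -> Y x = E x * (A * sin (theta x) + B * cos (theta x)).
  by case/XYE.
pose N := A ^+ 2 + B ^+ 2.
have N0 : N != 0.
  rewrite paddr_eq0 ?sqr_ge0 // !sqrf_eq0; apply/negP => /andP[/eqP A0 /eqP B0].
  have := affine_form_deriv_slope 1 0 x0 x0I.
  have -> : affine_form y (1 * m11 + 0 * m21) (1 * m12 + 0 * m22)
      (1 * v1 + 0 * v2) x0 = alpha * X x0 - w * Y x0.
    by rewrite /X /Y /affine_form v1E /r1 /r2; field; rewrite w0.
  have X0 : X x0 = 0 by rewrite XE // A0 B0 !mul0r subrr mulr0.
  have Y0 : Y x0 = 0 by rewrite YE // A0 B0 !mul0r addr0 mulr0.
  rewrite X0 Y0 !mulr0 subrr mul0r addr0 mulr1 => /eqP.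
  by rewrite (negPf (lt0r_neq0 (phi_gt0 x0 x0I))).
(* xi + i eta = (X + i Y) / (A + i B). *)
pose xi := affine_form y ((A + B * r1) / N) (B * r2 / N)
  ((- A * p1 - B * (r1 * p1 + r2 * p2)) / N).
pose eta := affine_form y ((A * r1 - B) / N) (A * r2 / N)
  ((B * p1 - A * (r1 * p1 + r2 * p2)) / N).
have xiE x : I x -> xi x = E x * cos (theta x).
  move=> Ix; have -> : xi x = (A * X x + B * Y x) / N.
    by rewrite /xi /X /Y /affine_form; field.
  by rewrite XE // YE // /N in N0 *; field.
have etaE x : I x -> eta x = E x * sin (theta x).
  move=> Ix; have -> : eta x = (A * Y x - B * X x) / N.
    by rewrite /eta /X /Y /affine_form; field.
  by rewrite XE // YE // /N in N0 *; field.
exists alpha, w; split=> //.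
exists [set Defs.point (xi x) (eta x) | x in I]; last first.
  apply: graph_affine_congruent.
  have -> : (A + B * r1) / N * (A * r2 / N) - B * r2 / N * ((A * r1 - B) / N)
    = r2 / N by rewrite /N in N0 *; field.
  by rewrite /r2 !mulf_neq0 ?invr_eq0 ?oppr_eq0.
have xi_deriv x (Ix : I x) := affine_form_deriv _ _ _ x Ix : deriv_at xi x _.
have eta_deriv x (Ix : I x) := affine_form_deriv _ _ _ x Ix : deriv_at eta x _.
have onG x : I x -> spiral_curve alpha w (Defs.point (xi x) (eta x)).
  by move=> Ix; exists (theta x) => //; rewrite xiE ?etaE.
have [alpha0|alpha0] := eqVneq alpha 0.
  (* A circle: the angles all lie in the right half plane. *)
  have E1 x : E x = 1 by rewrite /E alpha0 mul0r mul0r expR0.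
  have cos_gt0 x : 0 < cos (theta x).
    by rewrite cos_atan invr_gt0 sqrtr_gt0 ltr_pwDl ?sqr_ge0.
  apply: (arc_of_parametrized I_itv (ex_intro _ x0 x0I)
    [set Z | 0 < Z ord0 ord0] (fun Z => Z (lift ord0 ord0) ord0)
    (f := fun x => sin (theta x)) xi_deriv eta_deriv).
  - apply: (@open_image _ _ I_open I_itv _
      (fun x => cos (theta x) * (w / phi x)) 1) => x Ix.
      exact: deriv_sin (theta_deriv x Ix).
    by rewrite mul1r mulr_gt0 ?cos_gt0 // divr_gt0 ?phi_gt0.
  - exact: coordinate_continuous.
  - exact: right_half_plane_open.
  - move=> x Ix; rewrite /= point_fst point_snd; split; first exact: onG.
      by rewrite xiE // E1 mul1r.
    by rewrite etaE // E1 mul1r.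
  - move=> Z x [t _ <-] /=; rewrite point_fst point_snd alpha0 !mul0r expR0 !mul1r.
    move=> cos_t Ix sin_t; rewrite xiE // etaE // E1 !mul1r -sin_t; congr Defs.point.
    apply/eqP; rewrite -(@eqrXn2 _ 2) ?ltW //.
    by rewrite !cos2sin2 sin_t.
(* A proper spiral meets each circle about the origin only once. *)
apply: (arc_of_parametrized I_itv (ex_intro _ x0 x0I) setT
  (fun Z => Z ord0 ord0 * Z ord0 ord0 +
    Z (lift ord0 ord0) ord0 * Z (lift ord0 ord0) ord0)
  (f := fun x => E x ^+ 2) xi_deriv eta_deriv).
- apply: (@open_image _ _ I_open I_itv _
    (fun x => 2 * (alpha / phi x) * E x ^+ 2) alpha) => x Ix.
    have ht := theta_deriv x Ix; have p0 := lt0r_neq0 (phi_gt0 x Ix).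
    by rewrite /E; differentiate; rewrite /=; field; rewrite p0 w0.
  have -> : alpha * (2 * (alpha / phi x) * E x ^+ 2) =
    2 * alpha ^+ 2 * E x ^+ 2 / phi x by ring.
  rewrite divr_gt0 ?phi_gt0 // mulr_gt0 ?exprn_even_gt0 ?E_neq0 ?orbT //.
  by rewrite mulr_gt0 // exprn_even_gt0.
- move=> Z; have c0 := @coordinate_continuous R ord0 Z.
  have c1 := @coordinate_continuous R (lift ord0 ord0) Z.
  exact: (continuousD (continuousM c0 c0) (continuousM c1 c1)).
- exact: openT.
- move=> x Ix; rewrite point_fst point_snd -!expr2; split=> //.
    exact: onG.
  by rewrite xiE // etaE // !exprMn -mulrDr trig subrK mulr1.
- move=> Z x [t _ <-] _ Ix; rewrite point_fst point_snd -!expr2.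
  rewrite !exprMn -mulrDr cos2sin2 subrK mulr1 => /eqP.
  rewrite eqrXn2 ?expR_ge0 // => /eqP /expR_inj /(mulfI _) -> //.
    by rewrite xiE // etaE.
  by rewrite mulf_neq0 ?invr_eq0.
Qed.


(** The discriminant of the matrix tells apart the normal forms. The curved
    orbits of a field with nilpotent matrix are parabolas. *)
Lemma positive_tangent_field_classification :
  ~ (m11 + m22 = 0 /\ m11 * m22 - m12 * m21 = 0) ->
  [\/ exists a : R, a != 0 /\ congruent_to_arc_of (graph_on I y) (power_curve a),
      exists a b : R, congruent_to_arc_of (graph_on I y) (xlnx_curve a b),
      exists a b : R, b != 0 /\
        congruent_to_arc_of (graph_on I y) (spiral_curve a b) |
      congruent_to_arc_of (graph_on I y) exp_curve].
Proof.
move=> not_nilpotent; set disc := (m11 - m22) ^+ 2 + 4 * (m12 * m21).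
have eigenvalue lam : (2 * lam - (m11 + m22)) ^+ 2 = disc ->
    exists al be, left_eigenvector lam al be.
  move=> lamE; apply: left_eigenvector_exists; rewrite /disc in lamE.
  have -> : lam ^+ 2 - (m11 + m22) * lam + (m11 * m22 - m12 * m21) =
    ((2 * lam - (m11 + m22)) ^+ 2 - ((m11 - m22) ^+ 2 + 4 * (m12 * m21))) / 4.
    by field.
  by rewrite lamE subrr mul0r.
have [disc_lt0|disc_gt0|disc0] := ltgtP disc 0.
- by apply: Or43; exact: spiral_case.
- pose s := Num.sqrt disc.
  have s_gt0 : 0 < s by rewrite sqrtr_gt0.
  have sE : s ^+ 2 = disc by rewrite sqr_sqrtr // ltW.
  pose lam := (m11 + m22 + s) / 2; pose mu := (m11 + m22 - s) / 2.
  have lam_mu : lam != mu by apply/eqP; rewrite /lam /mu; lra.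
  have [|al [be eig_lam]] := eigenvalue lam.
    by rewrite -sE /lam; field.
  have [|al' [be' eig_mu]] := eigenvalue mu.
    by rewrite -sE /mu; field.
  have [lam0|lam0] := eqVneq lam 0.
    rewrite lam0 in eig_lam lam_mu.
    by apply: Or44; apply: exponential_case eig_mu eig_lam; rewrite eq_sym.
  have [mu0|mu0] := eqVneq mu 0.
    rewrite mu0 in eig_mu.
    by apply: Or44; apply: exponential_case eig_lam eig_mu.
  apply: Or41; exists (mu / lam); split; first by rewrite mulf_neq0 ?invr_eq0.
  exact: power_case eig_lam eig_mu.
- pose lam := (m11 + m22) / 2.
  have lamE : m11 + m22 = 2 * lam by rewrite /lam; field.
  have lam0 : lam != 0.
    apply/eqP => lam0; apply: not_nilpotent; rewrite lamE lam0 mulr0; split=> //.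
    have -> : m11 * m22 - m12 * m21 = ((m11 + m22) ^+ 2 - disc) / 4.
      by rewrite /disc; field.
    by rewrite lamE lam0 disc0 mulr0 expr0n subrr mul0r.
  have [|al [be eig]] := eigenvalue lam.
    by rewrite -lamE subrr expr0n disc0.
  by apply: Or42; exact: logarithmic_case eig.
Qed.

End TangentToAffineField.

(** The horizontal component of the field keeps a constant sign, and replacing
    the field by its opposite makes it positive. *)
Lemma tangent_field_classification {R : realType} {I : set R}
    (y dy ddy : R -> R) (m11 m12 v1 m21 m22 v2 : R) :
  open I -> is_interval I -> I !=set0 ->
  (forall x, I x -> deriv_at y x (dy x)) ->
  (forall x, I x -> deriv_at dy x (ddy x)) ->
  (forall x, I x -> ddy x != 0) ->
  (forall x, I x -> affine_form y m11 m12 v1 x != 0) ->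
  (forall x, I x ->
    affine_form y m11 m12 v1 x * dy x = affine_form y m21 m22 v2 x) ->
  ~ (m11 + m22 = 0 /\ m11 * m22 - m12 * m21 = 0) ->
  [\/ exists a : R, a != 0 /\ congruent_to_arc_of (graph_on I y) (power_curve a),
      exists a b : R, congruent_to_arc_of (graph_on I y) (xlnx_curve a b),
      exists a b : R, b != 0 /\
        congruent_to_arc_of (graph_on I y) (spiral_curve a b) |
      congruent_to_arc_of (graph_on I y) exp_curve].
Proof.
move=> I_open I_itv [x0 x0I] y_deriv dy_deriv ddy_neq0 phi_neq0 tangent trdet.
have phi_deriv x : I x ->
    deriv_at (affine_form y m11 m12 v1) x (m11 + m12 * dy x).
  move=> Ix; have hy := y_deriv x Ix.
  by rewrite /affine_form; differentiate; ring.
have sgn x (Ix : I x) :=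
  nonvanishing_constant_sign I_itv phi_deriv phi_neq0 x x0 Ix x0I.
have [phi0|phi0|] := ltgtP (affine_form y m11 m12 v1 x0) 0; last first.
- by move/eqP; rewrite (negPf (phi_neq0 x0 x0I)).
- apply: (positive_tangent_field_classification I_open I_itv _ _ _ _ _ _ _ _ _ x0
    x0I y_deriv dy_deriv ddy_neq0 _ tangent trdet) => x Ix.
  by have := sgn x Ix; rewrite pmulr_lgt0.
- have oppE a b c x : affine_form y (- a) (- b) (- c) x = - affine_form y a b c x.
    by rewrite /affine_form; ring.
  apply: (positive_tangent_field_classification I_open I_itv y dy ddy
    (- m11) (- m12) (- v1) (- m21) (- m22) (- v2) x0 x0I y_deriv dy_deriv ddy_neq0).
  + by move=> x Ix; rewrite oppE oppr_gt0; have := sgn x Ix; rewrite nmulr_lgt0.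
  + by move=> x Ix; rewrite !oppE mulNr tangent.
  + move=> [tr0 det0]; apply: trdet; split; first lra.
    by rewrite -det0; ring.
Qed.

(** * The affine field of a curve of constant curvature *)

(** Here [q] is [sqrt |S2|] and [eps] is the sign of [S2]; up to a constant
    factor, [dx / phi] with [phi = y2 / q] is the arc length element invariant
    under affine maps. The last two hypotheses are the definitions of [S2] and of
    the curvature, solved for [y4] and for the derivative of [q]. Differentiating
    [phi = m11 x + m12 y + v1] and [phi y1 = m21 x + m22 y + v2] along the curve
    determines the entries of the matrix as functions of [x], the [f]s of the
    proof, and the last two hypotheses make these functions constant. *)
Lemma constant_curvature_affine_field {R : realType} {I : set R}
    (y y1 y2 y3 q : R -> R) (eps c : R) :
  is_interval I -> I !=set0 ->
  (forall x, I x -> y2 x != 0) -> (forall x, I x -> q x != 0) ->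
  (forall x, I x -> deriv_at y x (y1 x)) ->
  (forall x, I x -> deriv_at y1 x (y2 x)) ->
  (forall x, I x -> deriv_at y2 x (y3 x)) ->
  (forall x, I x ->
    deriv_at y3 x ((eps * q x ^+ 2 + 5 * y3 x ^+ 2) / (3 * y2 x))) ->
  (forall x, I x ->
    deriv_at q x ((eps * c * q x ^+ 2 + 8 * y3 x * q x) / (6 * y2 x))) ->
  exists m11 m12 v1 m21 m22 v2 : R,
    [/\ m11 + m22 = - (eps * c) / 2,
        m11 * m22 - m12 * m21 = eps / 9 + (eps * c) ^+ 2 / 18,
        forall x, I x -> y2 x / q x = affine_form y m11 m12 v1 x &
        forall x, I x -> y2 x / q x * y1 x = affine_form y m21 m22 v2 x].
Proof.
move=> I_itv [x0 x0I] y2_neq0 q_neq0 hy hy1 hy2 hy3 hq.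
pose phi x := y2 x / q x.
pose dphi x := - (y3 x / q x) / 3 - eps * c / 6.
pose f12 x := - (2 * eps * q x + 2 * y3 x ^+ 2 / q x - eps * c * y3 x)
  / (18 * y2 x ^+ 2).
pose f11 x := dphi x - f12 x * y1 x.
pose f22 x := f12 x * y1 x + y3 x / q x / 3 - eps * c / 3.
pose f21 x := dphi x * y1 x + phi x * y2 x - f22 x * y1 x.
have phi_deriv x : I x -> deriv_at phi x (dphi x).
  move=> Ix; have d2 := hy2 x Ix; have dq := hq x Ix.
  have n2 := y2_neq0 x Ix; have nq := q_neq0 x Ix.
  by rewrite /phi; differentiate; rewrite /dphi; field; rewrite nq n2.
have f12_deriv x : I x -> deriv_at f12 x 0.
  move=> Ix; have d2 := hy2 x Ix; have d3 := hy3 x Ix; have dq := hq x Ix.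
  have n2 := y2_neq0 x Ix; have nq := q_neq0 x Ix.
  have n18 : 18 * y2 x ^+ 2 != 0 by rewrite mulf_neq0 ?sqrf_eq0 ?pnatr_eq0.
  by rewrite /f12; differentiate; rewrite /=; field; rewrite nq n2.
have p_deriv x : I x -> deriv_at (fun t => y3 t / q t) x (- 3 * (f12 x * y2 x)).
  move=> Ix; have d3 := hy3 x Ix; have dq := hq x Ix.
  have n2 := y2_neq0 x Ix; have nq := q_neq0 x Ix.
  by differentiate; rewrite /f12; field; rewrite nq n2.
have dphi_deriv x : I x -> deriv_at dphi x (f12 x * y2 x).
  move=> Ix; have dp := p_deriv x Ix; have nq := q_neq0 x Ix.
  by rewrite /dphi; differentiate; field; rewrite nq.
have f11_deriv x : I x -> deriv_at f11 x 0.
  move=> Ix; have d1 := hy1 x Ix; have d12 := f12_deriv x Ix.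
  have dd := dphi_deriv x Ix.
  by rewrite /f11; differentiate; ring.
have f22_deriv x : I x -> deriv_at f22 x 0.
  move=> Ix; have d1 := hy1 x Ix; have d12 := f12_deriv x Ix.
  have dp := p_deriv x Ix; have nq := q_neq0 x Ix.
  by rewrite /f22; differentiate; field; rewrite nq.
have f21_deriv x : I x -> deriv_at f21 x 0.
  move=> Ix; have d1 := hy1 x Ix; have d22 := f22_deriv x Ix.
  have d2 := hy2 x Ix; have dp := phi_deriv x Ix; have dd := dphi_deriv x Ix.
  have nq := q_neq0 x Ix.
  rewrite /f21; differentiate; rewrite /f22 /dphi /phi; field.
  by rewrite nq.
have f11E x (Ix : I x) := derive0_constant I_itv f11_deriv x x0 Ix x0I.
have f12E x (Ix : I x) := derive0_constant I_itv f12_deriv x x0 Ix x0I.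
have f21E x (Ix : I x) := derive0_constant I_itv f21_deriv x x0 Ix x0I.
have f22E x (Ix : I x) := derive0_constant I_itv f22_deriv x x0 Ix x0I.
have rest1_deriv x : I x ->
    deriv_at (fun t => phi t - (f11 x0 * t + f12 x0 * y t)) x 0.
  move=> Ix; have d0 := hy x Ix; have dp := phi_deriv x Ix.
  by differentiate; rewrite -(f11E x Ix) -(f12E x Ix) /f11; ring.
have rest2_deriv x : I x ->
    deriv_at (fun t => phi t * y1 t - (f21 x0 * t + f22 x0 * y t)) x 0.
  move=> Ix; have d0 := hy x Ix; have d1 := hy1 x Ix; have dp := phi_deriv x Ix.
  by differentiate; rewrite -(f21E x Ix) -(f22E x Ix) /f21; ring.
exists (f11 x0), (f12 x0), (phi x0 - (f11 x0 * x0 + f12 x0 * y x0)).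
exists (f21 x0), (f22 x0), (phi x0 * y1 x0 - (f21 x0 * x0 + f22 x0 * y x0)).
have n2 := y2_neq0 x0 x0I; have nq := q_neq0 x0 x0I.
split.
- by rewrite /f11 /f22 /dphi; field; rewrite nq.
- rewrite /f21 /f11 /f22 /f12 /dphi /phi; field.
  by rewrite nq n2.
- move=> x Ix; rewrite -(derive0_constant I_itv rest1_deriv x x0 Ix x0I).
  by rewrite /affine_form /phi; ring.
- move=> x Ix; rewrite -(derive0_constant I_itv rest2_deriv x x0 Ix x0I).
  by rewrite /affine_form /phi; ring.
Qed.

(** The matrix of the field is not nilpotent, because its trace and determinant
    are [- eps c / 2] and [eps / 9 + c^2 / 18] with [c = sqrt 3 k] and
    [eps = 1] or [-1]: a zero trace forces [c = 0], and then the determinant is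
    not zero. *)
Lemma constant_curvature_tangent_field {R : realType} {I : set R}
    (y y1 y2 y3 y4 y5 : R -> R) (k : R)
    (S := fun x => 3 * y2 x * y4 x - 5 * y3 x ^+ 2) :
  is_interval I -> I !=set0 ->
  (forall x, I x -> deriv_at y x (y1 x)) ->
  (forall x, I x -> deriv_at y1 x (y2 x)) ->
  (forall x, I x -> deriv_at y2 x (y3 x)) ->
  (forall x, I x -> deriv_at y3 x (y4 x)) ->
  (forall x, I x -> deriv_at y4 x (y5 x)) ->
  (forall x, I x -> y2 x != 0) -> (forall x, I x -> S x != 0) ->
  (forall x, I x -> Num.sqrt 3 *
    (9 * y2 x ^+ 2 * y5 x - 45 * y2 x * y3 x * y4 x + 40 * y3 x ^+ 3)
    / (3 * `|S x| `^ (3 / 2)) = k) ->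
  exists m11 m12 v1 m21 m22 v2 : R,
    [/\ ~ (m11 + m22 = 0 /\ m11 * m22 - m12 * m21 = 0),
        forall x, I x -> affine_form y m11 m12 v1 x != 0 &
        forall x, I x ->
          affine_form y m11 m12 v1 x * y1 x = affine_form y m21 m22 v2 x].
Proof.
move=> I_itv [x0 x0I] y0_deriv y1_deriv y2_deriv y3_deriv y4_deriv.
move=> y2_neq0 S_neq0 curvature_k.
have S_deriv x : I x ->
    deriv_at S x (3 * y3 x * y4 x + 3 * y2 x * y5 x - 10 * y3 x * y4 x).
  move=> Ix; have d2 := y2_deriv x Ix; have d3 := y3_deriv x Ix.
  have d4 := y4_deriv x Ix.
  by rewrite /S; differentiate; rewrite /=; ring.
pose eps := Num.sg (S x0).
have eps2 : eps * eps = 1.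
  by rewrite /eps -expr2 sqr_sg S_neq0.
have eps_S x : I x -> `|S x| = eps * S x.
  move=> Ix.
  have := nonvanishing_constant_sign I_itv S_deriv S_neq0 x x0 Ix x0I.
  rewrite /eps; have [S0|S0|S0] := ltgtP (S x0) 0.
  - by rewrite nmulr_lgt0 // => Sx; rewrite ltr0_sg // ltr0_norm // mulN1r.
  - by rewrite pmulr_lgt0 // => Sx; rewrite gtr0_sg // gtr0_norm // mul1r.
  - by move: (S_neq0 x0 x0I); rewrite S0 eqxx.
have eps_S_gt0 x : I x -> 0 < eps * S x.
  by move=> Ix; rewrite -eps_S // normr_gt0 S_neq0.
pose q x := Num.sqrt (eps * S x).
have q_gt0 x : I x -> 0 < q x by move=> Ix; rewrite sqrtr_gt0 eps_S_gt0.
have q_neq0 x (Ix : I x) := lt0r_neq0 (q_gt0 x Ix).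
have q2 x : I x -> eps * q x ^+ 2 = S x.
  by move=> Ix; rewrite sqr_sqrtr ?ltW ?eps_S_gt0 // mulrA eps2 mul1r.
pose c := Num.sqrt 3 * k.
have curv x : I x ->
    9 * y2 x ^+ 2 * y5 x - 45 * y2 x * y3 x * y4 x + 40 * y3 x ^+ 3 =
    c * q x ^+ 3.
  move=> Ix; have := curvature_k x Ix; rewrite -/(S x).
  set K := 9 * y2 x ^+ 2 * y5 x - _ + _.
  have -> : `|S x| `^ (3 / 2) = q x ^+ 3.
    rewrite eps_S // [3 / 2]mulrC powRrM powR12_sqrt ?powR_mulrn ?sqrtr_ge0 //.
    by rewrite ltW // eps_S_gt0.
  have r3 : Num.sqrt 3 ^+ 2 = 3 :> R by rewrite sqr_sqrtr.
  move=> kK; rewrite /c -kK.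
  have -> : Num.sqrt 3 * (Num.sqrt 3 * K / (3 * q x ^+ 3)) * q x ^+ 3 =
    Num.sqrt 3 ^+ 2 * K / 3 by field; rewrite q_neq0.
  by rewrite r3; field.
have y3_deriv' x : I x ->
    deriv_at y3 x ((eps * q x ^+ 2 + 5 * y3 x ^+ 2) / (3 * y2 x)).
  move=> Ix; apply: deriv_eq (y3_deriv x Ix) _.
  by have n2 := y2_neq0 x Ix; rewrite q2 // /S /=; field.
have q_deriv x : I x ->
    deriv_at q x ((eps * c * q x ^+ 2 + 8 * y3 x * q x) / (6 * y2 x)).
  move=> Ix; have dS := S_deriv x Ix; have epsS := eps_S_gt0 x Ix.
  have n2 := y2_neq0 x Ix; have nq := q_neq0 x Ix.
  rewrite {1}/q; differentiate; rewrite -/(q x).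
  have S' : 3 * y2 x * (3 * y3 x * y4 x + 3 * y2 x * y5 x - 10 * y3 x * y4 x)
      = c * q x ^+ 3 + 8 * y3 x * (eps * q x ^+ 2).
    by rewrite -curv // q2 // /S /=; ring.
  have {S'} -> : 3 * y3 x * y4 x + 3 * y2 x * y5 x - 10 * y3 x * y4 x =
      (c * q x ^+ 3 + 8 * y3 x * (eps * q x ^+ 2)) / (3 * y2 x).
    by rewrite -S'; field.
  transitivity
    ((eps * c * q x ^+ 2 + (eps * eps) * (8 * y3 x * q x)) / (6 * y2 x)).
    by field; rewrite nq n2.
  by rewrite eps2 mul1r.
have [m11 [m12 [v1 [m21 [m22 [v2 [trE detE phiE tangent]]]]]]] :=
  constant_curvature_affine_field y y1 y2 y3 q eps c I_itv (ex_intro _ x0 x0I)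
    y2_neq0 q_neq0 y0_deriv y1_deriv y2_deriv y3_deriv' q_deriv.
exists m11, m12, v1, m21, m22, v2; split.
- move=> [tr0 det0]; have epsc : eps * c = 0 by lra.
  have eps0 : eps = 0 by rewrite epsc expr0n /= in detE; lra.
  by move/eqP: eps2; rewrite eps0 mulr0 eq_sym oner_eq0.
- by move=> x Ix; rewrite -phiE // mulf_neq0 ?invr_eq0 ?y2_neq0 ?q_neq0.
- by move=> x Ix; rewrite -phiE // tangent.
Qed.

(** * The classification *)

Theorem theorem6p2 (R : realType) (I : set R) (y : R -> R)
    (I_open : open I) (I_itv : is_interval I) (I_nonempty : I !=set0)
    (y_smooth : smooth_on I y) (y_regular : regular_on I y)
    (k_constant : exists k : R, forall x : R, I x -> curvature y x = k) :
  [\/ exists a : R, a != 0 /\ congruent_to_arc_of (graph_on I y) (power_curve a),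
      exists a b : R, congruent_to_arc_of (graph_on I y) (xlnx_curve a b),
      exists a b : R, b != 0 /\
        congruent_to_arc_of (graph_on I y) (spiral_curve a b) |
      congruent_to_arc_of (graph_on I y) exp_curve].
Proof.
have [k kE] := k_constant.
have Y_deriv n x : I x -> deriv_at (derive1n n y) x (derive1n n.+1 y x).
  move=> Ix; apply: (is_derive_eq (derivableP (y_smooth n x Ix))).
  by rewrite derive1nS derive1E.
have y2_neq0 x (Ix : I x) := (y_regular x Ix).1.
have [m11 [m12 [v1 [m21 [m22 [v2 [not_nilpotent phi_neq0 tangent]]]]]]] :=
  constant_curvature_tangent_field y (derive1n 1 y) (derive1n 2 y)
    (derive1n 3 y) (derive1n 4 y) (derive1n 5 y) k I_itv I_nonempty
    (Y_deriv 0) (Y_deriv 1) (Y_deriv 2) (Y_deriv 3) (Y_deriv 4) y2_neq0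
    (fun x Ix => (y_regular x Ix).2) kE.
exact: (tangent_field_classification y (derive1n 1 y) (derive1n 2 y)
  m11 m12 v1 m21 m22 v2 I_open I_itv I_nonempty (Y_deriv 0) (Y_deriv 1)
  y2_neq0 phi_neq0 tangent not_nilpotent).
Qed.
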